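(* Let $g_i:\{-1,1\}^{n_i}\to\{-1,1\}$ for $i=1,\dots,k$ and $f:\{-1,1\}^k\to\{-1,1\}$, and let $h(x^1,\dots,x^k)=f(g_1(x^1),\dots,g_k(x^k))$, where $x^1,\dots,x^k$ are disjoint blocks of variables and the domain of $h$ is endowed with a product distribution $\mu$. Let $\eta=\langle\mathbb{E}_\mu[g_1],\dots,\mathbb{E}_\mu[g_k]\rangle$. Suppose there are $C$-good protocols for $g_1,\dots,g_k$ under $\mu$ (restricted to the respective blocks) and a $C$-good protocol for $f$ under bias $\eta$. Then there exists a $C$-good protocol for $h$ under bias $\mu$.
   Context: For biases $\mu=\langle\mu_1,\dots,\mu_n\rangle$ with $|\mu_i|<1$, $\{-1,1\}^n_\mu$ denotes $\{-1,1\}^n$ with the product distribution in which the bits are independent and $\mathbb{E}_\mu[x_i]=\mu_i$, $\mathrm{Var}_\mu[x_i]=1-\mu_i^2$. The $\mu$-biased Fourier expansion of $F:\{-1,1\}^n_\mu\to\mathbb{R}$ is $F=\sum_S\widetilde F(S)\phi^\mu_S$ with $\phi^\mu_S(x)=\prod_{i\in S}\frac{x_i-\mu_i}{\sqrt{1-\mu_i^2}}$ and $\widetilde F(S)=\mathbb{E}_\mu[F\phi^\mu_S]$. For Boolean $F$ with $\mathrm{Var}_\mu[F]>0$, the distribution $\widetilde F^2\setminus\emptyset$ on subsets of $[n]$ gives $\emptyset$ probability $0$ and each nonempty $S$ probability $\widetilde F(S)^2/(1-\widetilde F(\emptyset)^2)$. A prefix-free protocol for a random set $\mathcal{Y}$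 is a map $P$ from sets to binary strings such that no codeword of one set is a prefix of that of another. Given $F:\{-1,1\}^n_\mu\to\{-1,1\}$ and $\mathcal{Y}\sim\widetilde F^2\setminus\emptyset$, a prefix-free protocol $P$ for $\mathcal{Y}$ is $C$-good for $F$ under bias $\mu$ if $$\mathbb{E}[|P(\mathcal{Y})|]\le C(\mathbb{E}[|\mathcal{Y}|]-1)+\sum_i\Pr[i\in\mathcal{Y}]\log_2\frac{1}{1-\mu_i^2}+\log_2\mathrm{Var}_\mu[F].$$ (All functions involved are assumed nonconstant so that these distributions are defined.) *)

(* Defs.v *)
From HB Require Import structures.
From mathcomp Require Import all_boot all_order all_algebra.
From mathcomp Require Import reals exp.

Set Implicit Arguments.
Unset Strict Implicit.
Unset Printing Implicit Defensive.

Import Order.TTheory GRing.Theory Num.Theory.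
Local Open Scope ring_scope.

Definition log2 {R : realType} (x : R) : R := ln x / ln 2.

(* {-1,1}^I: a bit b stands for the sign (-1)^b. Variables are indexed by an
   arbitrary finite type, so that blocks can be indexed by a sigma type. *)
Definition cube (I : finType) := {ffun I -> bool}.

Definition sgn (R : realType) (b : bool) : R := (-1) ^+ b.

Definition nonconstant (I : finType) (F : cube I -> bool) : Prop :=
  exists x y, F x <> F y.

Section Biased.
Variables (R : realType) (I : finType).
Implicit Types (mu : I -> R) (F : cube I -> bool) (S : {set I}).

Definition is_bias mu : Prop := forall i, `|mu i| < 1.

(* The law of a sign x_i with mean mu_i is Pr[x_i = s] = (1 + s mu_i) / 2. *)
Definition cube_prob mu (x : cube I) : R :=
  \prod_i ((1 + sgn R (x i) * mu i) / 2).

Definition expect mu (G : cube I -> R) : R := \sum_x cube_prob mu x * G x.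

Definition variance mu (G : cube I -> R) : R :=
  expect mu (fun x => (G x - expect mu G) ^+ 2).

Definition phi mu S (x : cube I) : R :=
  \prod_(i in S) ((sgn R (x i) - mu i) / Num.sqrt (1 - mu i ^+ 2)).

Definition fourier mu (G : cube I -> R) S : R :=
  expect mu (fun x => G x * phi mu S x).

Definition real_fun F (x : cube I) : R := sgn R (F x).

Definition spectral_prob mu F S : R :=
  if S == set0 then 0
  else fourier mu (real_fun F) S ^+ 2
       / (1 - fourier mu (real_fun F) set0 ^+ 2).

Definition spectral_expect mu F (X : {set I} -> R) : R :=
  \sum_S spectral_prob mu F S * X S.

Definition spectral_mem_prob mu F (i : I) : R :=
  \sum_(S : {set I} | i \in S) spectral_prob mu F S.

(* Prefix-freeness is about the codewords of the possible values of the random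
   set, i.e. the sets of positive probability; values of P elsewhere are junk.
   (Prefix-freeness over all sets would rule out the empty codeword, which is
   the only one meeting the bound of [C_good] when F is a single variable.) *)
Definition prefix_free_protocol mu F (P : {set I} -> seq bool) : Prop :=
  forall S T, 0 < spectral_prob mu F S -> 0 < spectral_prob mu F T ->
    S <> T -> ~~ prefix (P S) (P T).

Definition C_good (C : R) mu F (P : {set I} -> seq bool) : Prop :=
  prefix_free_protocol mu F P /\
  spectral_expect mu F (fun S => (size (P S))%:R) <=
    C * (spectral_expect mu F (fun S => #|S|%:R) - 1)
    + \sum_i spectral_mem_prob mu F i * log2 (1 / (1 - mu i ^+ 2))
    + log2 (variance mu (real_fun F)).

End Biased.

Section Blocks.
Variables (k : nat) (n : 'I_k -> nat).

(* Index (i, j) of the j-th variable of block i. *)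
Definition block_var : finType := {i : 'I_k & 'I_(n i)}.

Definition in_block (i : 'I_k) (j : 'I_(n i)) : block_var :=
  Tagged (fun i => 'I_(n i)) j.

Definition block_bias (R : realType) (mu : block_var -> R) (i : 'I_k) :
  'I_(n i) -> R := fun j => mu (in_block j).

Definition block (x : cube block_var) (i : 'I_k) : cube 'I_(n i) :=
  [ffun j => x (in_block j)].

Definition compose (f : cube 'I_k -> bool)
    (g : forall i : 'I_k, cube 'I_(n i) -> bool) (x : cube block_var) : bool :=
  f [ffun i => g i (block x i)].

End Blocks.

Arguments block_bias {k n R} mu i _.

(* Main.v *)
Require Import Defs.
From mathcomp Require Import all_boot all_order all_algebra.
From mathcomp Require Import reals exp.
From mathcomp Require Import ring lra.

(** Write [h] for the composition and [S_i] for the part of [S] in block [i], and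
    call block [i] active for [S] when [S_i] is nonempty.  If [T] is the set of
    active blocks of [S], then the Fourier coefficient of [h] at [S] is the
    coefficient of [f] at [T] times the product over [i] in [T] of
    [g~_i(S_i) / sqrt (1 - eta_i ^ 2)].  Hence a spectral sample of [h] is obtained
    by drawing [T] from the spectral distribution of [f] and then, independently for
    the blocks of [T], the parts [S_i] from that of [g_i].  Sending the codeword of
    [T] followed by those of the [S_i] is prefix-free, and in its expected length
    the terms [log2 (1 / (1 - eta_i ^ 2))] of [f] cancel against the terms
    [log2 (Var g_i)] of the inner functions. *)

Set Implicit Arguments.
Unset Strict Implicit.
Unset Printing Implicit Defensive.

Import Order.TTheory GRing.Theory Num.Theory.
Local Open Scope ring_scope.

(** * Prefixes of concatenations *)

Section Prefix.
Variables (T : eqType).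
Implicit Types s t : seq T.

(** When one concatenation is a prefix of another, either first part may be the shorter one; hence
    the symmetric form. *)
Definition prefix_comparable s t := prefix s t || prefix t s.

Lemma prefix_cat_comparable s1 s2 t1 t2 :
  prefix (s1 ++ s2) (t1 ++ t2) -> prefix_comparable s1 t1.
Proof.
rewrite /prefix_comparable.
elim: s1 t1 => [|x s1 IH] [|y t1] //=; rewrite ?prefix0s //.
by case/andP=> /eqP-> /IH; rewrite eqxx.
Qed.

(** The hypothesis makes comparable heads equal, so they cancel one after another and the prefix
    relation passes to the tails. *)
Lemma prefix_flatten_comparable (I : eqType) (u v : I -> seq T) (r : seq I) :
  (forall i, i \in r -> prefix_comparable (u i) (v i) -> u i = v i) ->
  prefix (flatten [seq u i | i <- r]) (flatten [seq v i | i <- r]) ->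
  forall i, i \in r -> prefix_comparable (u i) (v i).
Proof.
elim: r => [|a r IH] //= uv pre i.
have cmp := prefix_cat_comparable pre.
have eq_uv := uv a (mem_head a r) cmp.
move: pre; rewrite eq_uv prefix_catr // eqxx /= => pre.
rewrite inE => /predU1P[->//|ir].
by apply: IH => // j jr; apply: uv; rewrite inE jr orbT.
Qed.

End Prefix.

(** * Dependent products over blocks *)

Lemma prod_sum_fprod (R : comPzRingType) (I : finType) (T : I -> finType)
    (F : forall i, T i -> R) :
  \prod_i \sum_(y : T i) F i y = \sum_(t : fprod T) \prod_i F i (t i).
Proof.
have -> : \sum_(t : fprod T) \prod_i F i (t i)
        = \sum_(t : fprod T) \prod_(i in I) [ffun y => F i y] (t i).
  by apply: eq_bigr => t _; apply: eq_bigr => i _; rewrite ffunE.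
rewrite big_fprod.
transitivity (\prod_i \sum_(j in tagged_with T i)
    untag 0 [ffun y => F i y] j); last exact: bigA_distr_big_dep.
apply: eq_bigr => i _.
by rewrite -(big_tag (fun i => [ffun y => F i y]));
  apply: eq_bigr => y _; rewrite ffunE.
Qed.

Section BlockProducts.
Variables (R : realType) (k : nat) (n : 'I_k -> nat).

Definition block_set (S : {set block_var n}) (i : 'I_k) : {set 'I_(n i)} :=
  [set j | in_block j \in S].

Definition active_blocks (S : {set block_var n}) : {set 'I_k} :=
  [set i | block_set S i != set0].

Lemma big_block_var (idx : R) (op : Monoid.com_law idx)
    (P : pred (block_var n)) (F : block_var n -> R) :
  \big[op/idx]_(p | P p) F p =
  \big[op/idx]_i \big[op/idx]_(j : 'I_(n i) | P (in_block j)) F (in_block j).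
Proof.
rewrite (sig_big_dep _ (fun i (j : 'I_(n i)) => P (in_block j))
  (fun i (j : 'I_(n i)) => F (in_block j))).
by apply: eq_big => -[i j].
Qed.

(** A point of the whole cube amounts to a free choice of one point per block, so distributivity
    applies. *)
Lemma sum_cube_prod_block (F : forall i, cube 'I_(n i) -> R) :
  \sum_(x : cube (block_var n)) \prod_i F i (block x i)
  = \prod_i \sum_(y : cube 'I_(n i)) F i y.
Proof.
rewrite (prod_sum_fprod (T := fun i => cube 'I_(n i))).
rewrite (reindex (fun t : fprod (fun i => cube 'I_(n i)) =>
  [ffun p : block_var n => t (tag p) (tagged p)])).
  apply: eq_bigr => t _; apply: eq_bigr => i _; congr F.
  by apply/ffunP=> j; rewrite !ffunE.
exists (fun x => [fprod i => block x i]) => [t _|x _].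
  by apply/fprodP => i; rewrite fprodE; apply/ffunP=> j; rewrite !ffunE.
by apply/ffunP=> -[i j]; rewrite !ffunE fprodE ffunE.
Qed.

Lemma sum_set_prod_block (F : forall i, {set 'I_(n i)} -> R) :
  \sum_(S : {set block_var n}) \prod_i F i (block_set S i)
  = \prod_i \sum_(A : {set 'I_(n i)}) F i A.
Proof.
rewrite (prod_sum_fprod (T := fun i => {set 'I_(n i)})).
rewrite (reindex (fun t : fprod (fun i => {set 'I_(n i)}) =>
  [set p : block_var n | tagged p \in t (tag p)])).
  apply: eq_bigr => t _; apply: eq_bigr => i _; congr F.
  by apply/setP=> j; rewrite !inE.
exists (fun S => [fprod i => block_set S i]) => [t _|S _].
  by apply/fprodP => i; rewrite fprodE; apply/setP=> j; rewrite !inE.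
by apply/setP=> -[i j]; rewrite !inE fprodE inE.
Qed.

Lemma active_blocks_eq0 (S : {set block_var n}) :
  (active_blocks S == set0) = (S == set0).
Proof.
apply/eqP/eqP => [A0|->]; last first.
  by apply/setP=> i; rewrite !inE; apply/negbTE/negPn/eqP/setP=> j; rewrite !inE.
apply/setP=> -[i j]; rewrite inE; apply/negbTE/negP => ijS.
have := in_set0 i; rewrite -A0 inE => /negbFE/eqP/setP/(_ j).
by rewrite !inE => /negP; apply.
Qed.

Lemma block_set_inj (S S' : {set block_var n}) :
  (forall i, block_set S i = block_set S' i) -> S = S'.
Proof.
move=> eqb; apply/setP=> -[i j].
by have /setP/(_ j) := eqb i; rewrite !inE.
Qed.

End BlockProducts.

(** * Biased Fourier analysis on one cube *)

Section Cube.
Variables (R : realType) (I : finType).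
Implicit Types (mu : I -> R) (F : cube I -> bool) (S : {set I}).

Lemma sgnE : (sgn R true = -1) * (sgn R false = 1).
Proof. by rewrite /sgn expr0 expr1. Qed.

Lemma sgn_sqr (b : bool) : sgn R b ^+ 2 = 1.
Proof. exact: sqrr_sign. Qed.

(** Each factor is 1 if the two signs agree and 0 otherwise. The indicator serves in the kernel
    identity and, later, to expand [f] over the values of the inner functions. *)
Lemma prod_agree (y z : cube I) :
  \prod_i ((1 + sgn R (y i) * sgn R (z i)) / 2) = (y == z)%:R.
Proof.
have agree (b c : bool) : (1 + sgn R b * sgn R c) / 2 = (b == c)%:R.
  by case: b; case: c; rewrite !sgnE /=; field.
have [->|neq] := eqVneq y z.
  by rewrite big1 // => i _; rewrite agree eqxx.
have /existsP[i yz] : [exists i, y i != z i].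
  apply: contraR neq => /existsPn eqyz; apply/eqP/ffunP=> i.
  by apply/eqP; have := eqyz i; rewrite negbK.
by rewrite (bigD1 i) //= agree (negbTE yz) mul0r.
Qed.

Lemma expect_prod mu (G : I -> bool -> R) :
  expect mu (fun x => \prod_i G i (x i))
  = \prod_i \sum_b (1 + sgn R b * mu i) / 2 * G i b.
Proof.
rewrite bigA_distr_bigA; apply: eq_bigr => x _.
by rewrite /cube_prob -big_split.
Qed.

Lemma sum_cube_prob mu : \sum_x cube_prob mu x = 1.
Proof.
have := expect_prod mu (fun _ _ => 1).
rewrite /expect [RHS]big1 => [<-|i _].
  by apply: eq_bigr => x _; rewrite big1 // mulr1.
by rewrite big_bool /= !sgnE; field.
Qed.

Lemma phi0 mu x : phi mu set0 x = 1.
Proof. by rewrite /phi big_set0. Qed.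

Lemma fourier0 mu (G : cube I -> R) : fourier mu G set0 = expect mu G.
Proof. by apply: eq_bigr => x _; rewrite phi0 mulr1. Qed.

Lemma expect_phi mu S : S != set0 -> expect mu (phi mu S) = 0.
Proof.
case/set0Pn => i iS.
pose c j b := if j \in S then (sgn R b - mu j) / Num.sqrt (1 - mu j ^+ 2) else 1.
have -> : expect mu (phi mu S) = expect mu (fun x => \prod_j c j (x j)).
  by apply: eq_bigr => x _; rewrite /phi big_mkcond.
rewrite expect_prod (bigD1 i) //= /c iS big_bool /= !sgnE.
by rewrite [X in X * _](_ : _ = 0) ?mul0r //; ring.
Qed.

Lemma variance_real_fun mu F :
  variance mu (real_fun R F) = 1 - expect mu (real_fun R F) ^+ 2.
Proof.
rewrite /variance; set m := expect _ (real_fun R F).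
have -> : expect mu (fun x => (real_fun R F x - m) ^+ 2)
   = \sum_x (cube_prob mu x * (1 + m ^+ 2)
             - cube_prob mu x * real_fun R F x * (m + m)).
  apply: eq_bigr => x _.
  by rewrite sqrrB sgn_sqr; ring.
rewrite sumrB -!mulr_suml sum_cube_prob -/(expect mu (real_fun R F)) -/m.
ring.
Qed.

(** * Positivity, Parseval's identity and total spectral mass *)

Section Bias.
Variables (mu : I -> R) (mu_bias : is_bias mu).

Lemma bias_sqr_lt1 i : 0 < 1 - mu i ^+ 2.
Proof. by rewrite subr_gt0 -real_normK ?num_real // expr_lt1. Qed.

Lemma cube_prob_gt0 x : 0 < cube_prob mu x.
Proof.
apply: prodr_gt0 => i _; apply: divr_gt0 => //.
have := mu_bias i; rewrite ltr_norml => /andP[lo hi].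
by case: (x i); rewrite sgnE; lra.
Qed.

(** Every point has positive probability, so zero variance would force [F] to equal its mean
    everywhere. *)
Lemma variance_gt0 F : nonconstant F -> 0 < variance mu (real_fun R F).
Proof.
case=> x [y neq]; rewrite /variance; set m := expect _ (real_fun R F).
have t_ge0 z : 0 <= cube_prob mu z * (real_fun R F z - m) ^+ 2.
  by rewrite mulr_ge0 ?sqr_ge0 // ltW // cube_prob_gt0.
have v_ge0 : 0 <= expect mu (fun z => (real_fun R F z - m) ^+ 2).
  by apply: sumr_ge0 => z _.
rewrite lt_neqAle v_ge0 andbT eq_sym; apply: contra_notN neq => v0.
have F_cst z : real_fun R F z = m.
  have /(_ z isT)/eqP : forall z, true ->
      cube_prob mu z * (real_fun R F z - m) ^+ 2 = 0.
    exact/psumr_eq0P/eqP.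
  by rewrite mulf_eq0 gt_eqF ?cube_prob_gt0 // sqrf_eq0 subr_eq0 => /eqP.
have := F_cst x; rewrite -(F_cst y).
exact: signr_inj.
Qed.

(* The reproducing kernel of the basis [phi] is a multiple of the identity,
   which gives Parseval's identity without expanding in the basis. *)
Lemma sum_phi_phi x y :
  cube_prob mu x * \sum_S phi mu S x * phi mu S y = (x == y)%:R.
Proof.
pose c i b := (sgn R b - mu i) / Num.sqrt (1 - mu i ^+ 2).
have -> : \sum_S phi mu S x * phi mu S y
   = \prod_i (c i (x i) * c i (y i) + 1).
  rewrite bigA_distr; apply: eq_bigr => S _.
  by rewrite /phi -big_split /= -big_mkcond.
rewrite -prod_agree -big_split; apply: eq_bigr => i _ /=.
have mu_gt0 := bias_sqr_lt1 i.
have -> : c i (x i) * c i (y i)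
   = (sgn R (x i) - mu i) * (sgn R (y i) - mu i) / (1 - mu i ^+ 2).
  rewrite /c mulrACA -invfM -expr2 sqr_sqrtr //; exact: ltW.
have mu_neq0 : 1 - mu i ^+ 2 != 0 by rewrite gt_eqF.
by case: (x i); case: (y i); rewrite !sgnE /=; field.
Qed.

Lemma parseval (G : cube I -> R) :
  \sum_S fourier mu G S ^+ 2 = expect mu (fun x => G x ^+ 2).
Proof.
(* Each square is opened as a double sum over the cube, and the sum over [S] is moved innermost to
   expose the kernel. *)
have -> : \sum_S fourier mu G S ^+ 2
   = \sum_x \sum_y cube_prob mu y * G y * G x *
       (cube_prob mu x * \sum_S phi mu S x * phi mu S y).
  under eq_bigr => S _.
    rewrite expr2 /fourier /expect mulr_suml.
    under eq_bigr do rewrite mulr_sumr.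
    over.
  rewrite exchange_big; apply: eq_bigr => x _.
  rewrite exchange_big; apply: eq_bigr => y _.
  rewrite !mulr_sumr; apply: eq_bigr => S _; ring.
apply: eq_bigr => x _; rewrite (bigD1 x) //= sum_phi_phi eqxx mulr1 big1.
  by rewrite addr0 -mulrA -expr2.
by move=> y; rewrite sum_phi_phi eq_sym => /negbTE ->; rewrite mulr0.
Qed.

Lemma spectral_prob_ge0 F S : 0 <= spectral_prob mu F S.
Proof.
rewrite /spectral_prob; case: ifP => // _.
rewrite divr_ge0 ?sqr_ge0 // fourier0 -variance_real_fun.
by apply: sumr_ge0 => x _; rewrite mulr_ge0 ?sqr_ge0 // ltW // cube_prob_gt0.
Qed.

Lemma sum_spectral_prob F :
  nonconstant F -> \sum_S spectral_prob mu F S = 1.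
Proof.
move=> ncF; have := variance_gt0 ncF; rewrite variance_real_fun => v_gt0.
rewrite (bigD1 set0) //= {1}/spectral_prob eqxx add0r.
have -> : \sum_(S | S != set0) spectral_prob mu F S
   = (\sum_(S | S != set0) fourier mu (real_fun R F) S ^+ 2)
     / (1 - expect mu (real_fun R F) ^+ 2).
  rewrite mulr_suml; apply: eq_bigr => S /negbTE S0.
  by rewrite /spectral_prob S0 fourier0.
have /eqP := parseval (real_fun R F).
rewrite (bigD1 set0) //= fourier0 eq_sym addrC -subr_eq => /eqP <-.
have -> : expect mu (fun x => real_fun R F x ^+ 2) = 1.
  by rewrite -(sum_cube_prob mu); apply: eq_bigr => x _; rewrite sgn_sqr mulr1.
by rewrite divff // gt_eqF.
Qed.

Lemma spectral_mem_prob_ge0 F i : 0 <= spectral_mem_prob mu F i.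
Proof. by apply: sumr_ge0 => S _; apply: spectral_prob_ge0. Qed.

End Bias.

Lemma spectral_prob0 mu F : spectral_prob mu F set0 = 0.
Proof. by rewrite /spectral_prob eqxx. Qed.

(** Linearity of expectation; the weight 1 gives the expected size. *)
Lemma sum_spectral_mem_prob mu F (w : I -> R) :
  \sum_i spectral_mem_prob mu F i * w i
  = spectral_expect mu F (fun S => \sum_(i in S) w i).
Proof.
under eq_bigr => i _ do rewrite /spectral_mem_prob mulr_suml big_mkcond.
rewrite exchange_big; apply: eq_bigr => S _.
by rewrite mulr_sumr [RHS]big_mkcond.
Qed.

Lemma spectral_expect_card mu F :
  spectral_expect mu F (fun S => #|S|%:R) = \sum_i spectral_mem_prob mu F i.
Proof.
have := sum_spectral_mem_prob mu F (fun=> 1).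
under eq_bigr do rewrite mulr1.
by move=> ->; apply: eq_bigr => S _; rewrite -sumr_const.
Qed.

Lemma prefix_free_comparable_inj mu F P S T :
  prefix_free_protocol mu F P ->
  0 < spectral_prob mu F S -> 0 < spectral_prob mu F T ->
  prefix_comparable (P S) (P T) -> S = T.
Proof.
move=> pf S_gt0 T_gt0; have [//|/eqP ST] := eqVneq S T.
rewrite /prefix_comparable (negbTE (pf _ _ S_gt0 T_gt0 ST)).
by rewrite (negbTE (pf _ _ T_gt0 S_gt0 (nesym ST))).
Qed.

End Cube.

(** * The spectral distribution of a composition *)

Section Composition.
Variables (R : realType) (k : nat) (n : 'I_k -> nat).
Variables (g : forall i : 'I_k, cube 'I_(n i) -> bool) (f : cube 'I_k -> bool).
Arguments g : clear implicits.
Variables (mu : block_var n -> R) (mu_bias : is_bias mu).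
Hypothesis g_nonconstant : forall i, nonconstant (g i).

Variable eta : 'I_k -> R.
Hypothesis eta_def : forall i, eta i = expect (block_bias mu i) (real_fun R (g i)).
Let h := compose f g.

Lemma block_is_bias i : is_bias (block_bias mu i).
Proof. by move=> j; apply: mu_bias. Qed.

(** The quantity is the variance of [g i], positive because [g i] is nonconstant. *)
Lemma eta_sqr_lt1 i : 0 < 1 - eta i ^+ 2.
Proof.
rewrite eta_def -variance_real_fun.
exact (variance_gt0 (@block_is_bias i) (g_nonconstant i)).
Qed.

Lemma eta_is_bias : is_bias eta.
Proof.
move=> i; rewrite -(@expr_lt1 _ 2) // real_normK ?num_real //.
by rewrite -subr_gt0 eta_sqr_lt1.
Qed.

Lemma expect_prod_block (G : forall i, cube 'I_(n i) -> R) :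
  expect mu (fun x => \prod_i G i (block x i))
  = \prod_i expect (block_bias mu i) (G i).
Proof.
rewrite /expect -sum_cube_prod_block; apply: eq_bigr => x _.
rewrite /cube_prob big_block_var -big_split; apply: eq_bigr => i _ /=.
by congr (_ * _); apply: eq_bigr => j _; rewrite ffunE.
Qed.

Lemma phi_block (S : {set block_var n}) x :
  phi mu S x = \prod_i phi (block_bias mu i) (block_set S i) (block x i).
Proof.
rewrite /phi big_block_var; apply: eq_bigr => i _.
by apply: eq_big => j; rewrite ?inE // ffunE.
Qed.

(* Conditioning block [i] on [g_i = y] multiplies the weight of [y] by the basis
   function of the bit [y] with mean [eta_i], since
   [(1 + s eta) (s - eta) = s (1 - eta ^ 2)] for a sign [s]. *)
Lemma expect_agree_phi i (y : bool) (A : {set 'I_(n i)}) :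
  expect (block_bias mu i) (fun x =>
    (1 + sgn R y * sgn R (g i x)) / 2 * phi (block_bias mu i) A x)
  = (1 + sgn R y * eta i) / 2 *
    (if A != set0 then (sgn R y - eta i) / Num.sqrt (1 - eta i ^+ 2)
       * (fourier (block_bias mu i) (real_fun R (g i)) A
          / Num.sqrt (1 - eta i ^+ 2))
     else 1).
Proof.
have -> : expect (block_bias mu i) (fun x =>
    (1 + sgn R y * sgn R (g i x)) / 2 * phi (block_bias mu i) A x)
  = (expect (block_bias mu i) (phi (block_bias mu i) A)
     + sgn R y * fourier (block_bias mu i) (real_fun R (g i)) A) / 2.
  rewrite /fourier /expect mulr_sumr -big_split mulr_suml.
  by apply: eq_bigr => x _ /=; rewrite /real_fun; ring.
have [->|A0] := eqVneq A set0.
  rewrite fourier0 mulr1 -eta_def; congr (_ / 2); congr (_ + _).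
  by rewrite -(sum_cube_prob (block_bias mu i)); apply: eq_bigr => x _;
    rewrite phi0 mulr1.
rewrite expect_phi // add0r /=.
have e_gt0 := eta_sqr_lt1 i.
rewrite [X in _ = _ * X]mulrACA -invfM -expr2 sqr_sqrtr ?ltW //.
have e_neq0 : 1 - eta i ^+ 2 != 0 by rewrite gt_eqF.
by case: y; rewrite !sgnE /=; field.
Qed.

(** Expanding [f] in indicators of the vector of inner values turns [h] into a sum of products over
    blocks. Independence reduces each product to single blocks, whose factors regroup into the law
    and the basis function for [eta]. *)
Lemma fourier_compose (S : {set block_var n}) :
  fourier mu (real_fun R h) S
  = fourier eta (real_fun R f) (active_blocks S) *
    \prod_(i in active_blocks S)
      (fourier (block_bias mu i) (real_fun R (g i)) (block_set S i)
       / Num.sqrt (1 - eta i ^+ 2)).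
Proof.
have hE x : real_fun R h x = \sum_y real_fun R f y *
    \prod_i ((1 + sgn R (y i) * sgn R (g i (block x i))) / 2).
  pose z : cube 'I_k := [ffun i => g i (block x i)].
  have agree (y : cube 'I_k) :
      \prod_i ((1 + sgn R (y i) * sgn R (g i (block x i))) / 2)
      = (y == z)%:R.
    by rewrite -prod_agree; apply: eq_bigr => i _; rewrite ffunE.
  rewrite (bigD1 z) //= agree eqxx mulr1 big1 ?addr0 // => y /negbTE yz.
  by rewrite agree yz mulr0.
rewrite [LHS]/fourier /expect /=.
under eq_bigr => x _ do rewrite hE mulr_suml mulr_sumr.
rewrite exchange_big /= [fourier eta _ _]/fourier [in RHS]/expect mulr_suml.
apply: eq_bigr => y _.
transitivity (real_fun R f y * expect mu (fun x => \prod_i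
    ((1 + sgn R (y i) * sgn R (g i (block x i))) / 2
     * phi (block_bias mu i) (block_set S i) (block x i)))).
  rewrite /expect mulr_sumr; apply: eq_bigr => x _.
  by rewrite [in RHS]big_split /= phi_block; ring.
rewrite (expect_prod_block (fun i z => (1 + sgn R (y i) * sgn R (g i z)) / 2
     * phi (block_bias mu i) (block_set S i) z)).
under eq_bigr => i _ do rewrite expect_agree_phi.
rewrite big_split /= -/(cube_prob eta y) -big_mkcond /=.
rewrite (eq_bigl (mem (active_blocks S))) => [|i]; last by rewrite !inE.
rewrite big_split /= -/(phi eta (active_blocks S) y); ring.
Qed.

Lemma fourier_compose0 :
  fourier mu (real_fun R h) set0 = fourier eta (real_fun R f) set0.
Proof.
have A0 : active_blocks (set0 : {set block_var n}) = set0.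
  by apply/eqP; rewrite active_blocks_eq0.
by rewrite fourier_compose A0 big_set0 mulr1.
Qed.

Lemma variance_compose :
  variance mu (real_fun R h) = variance eta (real_fun R f).
Proof. by rewrite !variance_real_fun -!fourier0 fourier_compose0. Qed.

(** Squaring turns each [Num.sqrt (1 - eta i ^+ 2)] into the normalization of the spectral
    distribution of [g i], and the outer normalizations agree because [h] and [f] have the same
    mean. *)
Lemma spectral_prob_compose (S : {set block_var n}) :
  spectral_prob mu h S
  = spectral_prob eta f (active_blocks S) *
    \prod_(i in active_blocks S)
      spectral_prob (block_bias mu i) (g i) (block_set S i).
Proof.
rewrite /spectral_prob active_blocks_eq0; case: ifP => [_|S0].
  by rewrite mul0r.
rewrite fourier_compose0 fourier_compose exprMn -prodrXl mulrAC.
congr (_ * _); apply: eq_bigr => i; rewrite inE => /negbTE ->.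
by rewrite exprMn exprVn sqr_sqrtr ?ltW ?eta_sqr_lt1 // fourier0 eta_def.
Qed.

(* The law of the part in block [i], given that [T] is the set of active blocks. *)
Definition block_law (T : {set 'I_k}) i (A : {set 'I_(n i)}) : R :=
  if i \in T then spectral_prob (block_bias mu i) (g i) A else (A == set0)%:R.

Lemma sum_block_law T i : \sum_A @block_law T i A = 1.
Proof.
rewrite /block_law; case: (i \in T).
  by rewrite sum_spectral_prob //; apply: block_is_bias.
by rewrite (bigD1 set0) //= eqxx big1 ?addr0 // => A /negbTE ->.
Qed.

Lemma prod_block_law T (S : {set block_var n}) :
  \prod_i block_law T (block_set S i)
  = if active_blocks S == T then
      \prod_(i in T) spectral_prob (block_bias mu i) (g i) (block_set S i)
    else 0.
Proof.
case: eqP => [<-|neq].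
  rewrite [RHS]big_mkcond; apply: eq_bigr => i _; rewrite /block_law inE.
  by case: eqP.
(* A block on which the two sets differ kills the product: an empty part has spectral probability 0,
   and a nonempty part outside [T] has mass 0. *)
have /existsP[i iT] : [exists i, (i \in active_blocks S) != (i \in T)].
  apply: contra_notT neq => /existsPn eqA; apply/setP=> i.
  by apply/eqP; have := eqA i; rewrite negbK.
rewrite (bigD1 i) //= /block_law; move: iT; rewrite inE.
case: (i \in T); have [S0|S0] := eqVneq (block_set S i) set0 => //= _.
  by rewrite S0 spectral_prob0 mul0r.
by rewrite mul0r.
Qed.

(** Only [T = active_blocks S] contributes; the sum over all [T] allows expectations to be computed
    conditionally on [T]. *)
Lemma spectral_prob_mixture (S : {set block_var n}) :
  spectral_prob mu h S
  = \sum_T spectral_prob eta f T * \prod_i block_law T (block_set S i).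
Proof.
rewrite (bigD1 (active_blocks S)) //= prod_block_law eqxx spectral_prob_compose.
rewrite [X in _ + X]big1 ?addr0 // => T; rewrite prod_block_law eq_sym => /negbTE ->.
by rewrite mulr0.
Qed.

(** The weight is absorbed into factor [i] and all other factors sum to 1. Taking [Z] as a family
    avoids transport along [l = i]. *)
Lemma block_law_marginal T i (Z : forall l, {set 'I_(n l)} -> R) :
  \sum_S (\prod_l block_law T (block_set S l)) * Z i (block_set S i)
  = \sum_A @block_law T i A * Z i A.
Proof.
pose F l (A : {set 'I_(n l)}) := block_law T A * (if l == i then Z l A else 1).
transitivity (\sum_S \prod_l F l (block_set S l)).
  apply: eq_bigr => S _; rewrite big_split /=; congr (_ * _).
  by rewrite -big_mkcond big_pred1_eq.
rewrite sum_set_prod_block (bigD1 i) //= [X in _ * X]big1 => [|l /negbTE li].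
  by rewrite mulr1; apply: eq_bigr => A _; rewrite /F eqxx.
rewrite -[RHS](sum_block_law T l); apply: eq_bigr => A _.
by rewrite /F li mulr1.
Qed.

Lemma block_law_active T (Y : {set 'I_k} -> R) :
  \sum_(S : {set block_var n})
    (\prod_l block_law T (block_set S l)) * Y (active_blocks S) = Y T.
Proof.
transitivity (\sum_(S : {set block_var n})
    (\prod_l block_law T (block_set S l)) * Y T).
  apply: eq_bigr => S _; rewrite prod_block_law.
  by case: eqP => [->|]; rewrite ?mul0r.
rewrite -mulr_suml sum_set_prod_block big1 ?mul1r // => l _.
exact: sum_block_law.
Qed.

(** Conditionally on [T], an active block has the spectral law of [g i], while an inactive one
    contributes [Z i set0 = 0]. *)
Lemma spectral_expect_compose (Y : {set 'I_k} -> R)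
    (Z : forall l, {set 'I_(n l)} -> R) :
  (forall i, Z i set0 = 0) ->
  spectral_expect mu h
    (fun S => Y (active_blocks S) + \sum_i Z i (block_set S i))
  = spectral_expect eta f Y
    + \sum_i spectral_mem_prob eta f i
             * spectral_expect (block_bias mu i) (g i) (Z i).
Proof.
move=> Z0; rewrite sum_spectral_mem_prob /spectral_expect -big_split /=.
under eq_bigr => S _ do rewrite spectral_prob_mixture mulr_suml.
rewrite exchange_big; apply: eq_bigr => T _ /=.
rewrite -mulrDr.
under eq_bigr => S _ do rewrite -mulrA.
rewrite -mulr_sumr; congr (_ * _).
under [LHS]eq_bigr => S _ do rewrite mulrDr.
rewrite big_split /= block_law_active; congr (_ + _).
under [LHS]eq_bigr => S _ do rewrite mulr_sumr.
rewrite exchange_big /= [RHS]big_mkcond; apply: eq_bigr => i _.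
rewrite block_law_marginal /block_law; case: (i \in T) => //.
rewrite (bigD1 set0) //= Z0 mulr0 add0r big1 // => A /negbTE ->.
by rewrite mul0r.
Qed.

Lemma sum_mem_prob_compose (w : block_var n -> R) :
  \sum_p spectral_mem_prob mu h p * w p
  = \sum_i spectral_mem_prob eta f i *
      \sum_j spectral_mem_prob (block_bias mu i) (g i) j * w (in_block j).
Proof.
rewrite sum_spectral_mem_prob.
pose Z l (A : {set 'I_(n l)}) := \sum_(j in A) w (in_block j).
transitivity (spectral_expect mu h (fun S => 0 + \sum_i Z i (block_set S i))).
  apply: eq_bigr => S _; rewrite add0r big_block_var; congr (_ * _).
  by apply: eq_bigr => i _; apply: eq_bigl => j; rewrite inE.
rewrite (spectral_expect_compose (fun=> 0)) => [|i]; last by rewrite /Z big_set0.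
rewrite {1}/spectral_expect big1 ?add0r => [|T _]; last by rewrite mulr0.
by apply: eq_bigr => i _; rewrite sum_spectral_mem_prob.
Qed.

(** * The composed protocol: prefix-freeness and expected length *)

Section Protocol.
Variables (Pf : {set 'I_k} -> seq bool).
Variables (Pg : forall i, {set 'I_(n i)} -> seq bool).

(** Inactive blocks cost no bits: the codeword of the active set already reveals them, and [Pg set0]
    is arbitrary. *)
Definition block_code i (A : {set 'I_(n i)}) : seq bool :=
  if A == set0 then [::] else Pg A.

Definition compose_protocol (S : {set block_var n}) : seq bool :=
  Pf (active_blocks S)
  ++ flatten [seq block_code (block_set S i) | i <- enum 'I_k].

Lemma compose_protocol_prefix_free :
  prefix_free_protocol eta f Pf ->
  (forall i, prefix_free_protocol (block_bias mu i) (g i) (@Pg i)) ->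
  prefix_free_protocol mu h compose_protocol.
Proof.
move=> pf_f pf_g S S' S_gt0 S'_gt0 neq; apply/negP => pre; apply: neq.
(* Prefix-freeness is only assumed on sets of positive probability, so positivity must pass from [U]
   to its active set and its parts. *)
have pos (U : {set block_var n}) : 0 < spectral_prob mu h U ->
    0 < spectral_prob eta f (active_blocks U) /\
    forall i, i \in active_blocks U ->
      0 < spectral_prob (block_bias mu i) (g i) (block_set U i).
  rewrite spectral_prob_compose => U_gt0; split.
    rewrite lt_neqAle spectral_prob_ge0 ?andbT; last exact: eta_is_bias.
    by apply: contraTneq U_gt0 => <-; rewrite mul0r ltxx.
  move=> i iU; rewrite lt_neqAle spectral_prob_ge0 ?andbT; last exact: block_is_bias.
  by apply: contraTneq U_gt0 => U0; rewrite (bigD1 i) //= -U0 mul0r mulr0 ltxx.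
have [Sf Sg] := pos _ S_gt0; have [S'f S'g] := pos _ S'_gt0.
have eqA : active_blocks S = active_blocks S'.
  exact: prefix_free_comparable_inj pf_f Sf S'f (prefix_cat_comparable pre).
move: pre; rewrite /compose_protocol eqA prefix_catr // eqxx /= => pre.
(* With equal active sets, the two parts are both empty or both nonempty; in the latter case
   prefix-freeness of [Pg] decides. *)
have inj i : prefix_comparable (block_code (block_set S i))
    (block_code (block_set S' i)) -> block_set S i = block_set S' i.
  rewrite /block_code; have := erefl (i \in active_blocks S).
  rewrite {2}eqA !inE.
  case: eqVneq => [->|S0]; case: eqVneq => [->|S'0] // _.
  by apply: (prefix_free_comparable_inj (pf_g i));
    [apply: Sg|apply: S'g]; rewrite inE.
apply: block_set_inj => i; apply: (inj i).
apply: (prefix_flatten_comparable _ pre); last by rewrite mem_enum.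
by move=> j _ /inj ->.
Qed.

Lemma compose_protocol_length :
  spectral_expect mu h (fun S => (size (compose_protocol S))%:R)
  = spectral_expect eta f (fun T => (size (Pf T))%:R)
    + \sum_i spectral_mem_prob eta f i *
        spectral_expect (block_bias mu i) (g i) (fun A => (size (Pg A))%:R).
Proof.
pose Z i (A : {set 'I_(n i)}) : R := (size (block_code A))%:R.
transitivity (spectral_expect mu h (fun S =>
    (size (Pf (active_blocks S)))%:R + \sum_i Z i (block_set S i))).
  apply: eq_bigr => S _; congr (_ * _).
  rewrite size_cat natrD size_flatten /shape -map_comp sumnE big_map.
  by rewrite big_enum /= natr_sum.
rewrite (spectral_expect_compose (fun T => (size (Pf T))%:R)) => [|i]; last first.
  by rewrite /Z /block_code eqxx.
congr (_ + _); apply: eq_bigr => i _; congr (_ * _); apply: eq_bigr => A _.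
by rewrite /Z /block_code; case: eqP => [->|//]; rewrite spectral_prob0 !mul0r.
Qed.

Lemma compose_protocol_good (C : R) :
  C_good C eta f Pf ->
  (forall i, C_good C (block_bias mu i) (g i) (@Pg i)) ->
  C_good C mu h compose_protocol.
Proof.
move=> [pf_f len_f] good_g; split.
  by apply: compose_protocol_prefix_free => // i; case: (good_g i).
rewrite compose_protocol_length variance_compose.
rewrite (sum_mem_prob_compose (fun p => log2 (1 / (1 - mu p ^+ 2)))).
rewrite spectral_expect_card.
under [\sum_i spectral_mem_prob mu h i]eq_bigr do
  rewrite -[spectral_mem_prob _ _ _]mulr1.
rewrite (sum_mem_prob_compose (fun=> 1)).
(* This is the only inequality used; what remains after it is an identity. *)
apply: le_trans (lerD len_f (ler_sum _ _)) _.
  move=> i _; apply: ler_wpM2l (proj2 (good_g i)).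
  exact/spectral_mem_prob_ge0/eta_is_bias.
rewrite spectral_expect_card.
have log_cancel i : log2 (variance (block_bias mu i) (real_fun R (g i)))
    = - log2 (1 / (1 - eta i ^+ 2)).
  rewrite variance_real_fun -eta_def /log2 div1r lnV ?posrE ?eta_sqr_lt1 //.
  by rewrite mulNr opprK.
have cardE i : spectral_expect (block_bias mu i) (g i) (fun S => #|S|%:R)
    = \sum_j spectral_mem_prob (block_bias mu i) (g i) j * 1.
  by rewrite spectral_expect_card; apply: eq_bigr => j _; rewrite mulr1.
(* The terms [- C] of the inner bounds, weighted by the membership probabilities, cancel [C] times
   the expected size of [T] in the bound for [f]; only its [- C] survives. *)
have splitE i (a b : R) : spectral_mem_prob eta f i *
      (C * (a - 1) + b + - log2 (1 / (1 - eta i ^+ 2)))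
    = C * (spectral_mem_prob eta f i * a) + spectral_mem_prob eta f i * b
      - (C * spectral_mem_prob eta f i
         + spectral_mem_prob eta f i * log2 (1 / (1 - eta i ^+ 2))).
  by ring.
under [X in _ + X <= _]eq_bigr => i _ do rewrite log_cancel cardE splitE.
rewrite sumrB !big_split /= -!mulr_sumr.
by rewrite le_eqVlt; apply/orP; left; apply/eqP; rewrite /block_bias; ring.
Qed.

End Protocol.
End Composition.

Theorem theorem1p12 (R : realType) (C : R) (k : nat) (n : 'I_k -> nat)
    (g : forall i : 'I_k, cube 'I_(n i) -> bool) (f : cube 'I_k -> bool)
    (mu : block_var n -> R) (eta : 'I_k -> R)
    (mu_bias : is_bias mu)
    (eta_def : forall i, eta i = expect (block_bias mu i) (real_fun R (g i)))
    (g_nonconstant : forall i, nonconstant (g i))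
    (f_nonconstant : nonconstant f)
    (g_good : forall i, exists P, C_good C (block_bias mu i) (g i) P)
    (f_good : exists P, C_good C eta f P) :
  exists P, C_good C mu (compose f g) P.
Proof.
have [Pg Pg_good] := fin_all_exists g_good.
have [Pf Pf_good] := f_good.
exists (compose_protocol Pf Pg).
exact (compose_protocol_good mu_bias g_nonconstant eta_def Pf_good Pg_good).
Qed.
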